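(* Let $\varepsilon\in[0,1]$, let $\mathcal{M}$ and $\mathcal{N}$ be finite LMCs, let $S$ be the disjoint union of their state spaces $S^{\mathcal{M}}$ and $S^{\mathcal{N}}$, and let $P$ be the transition function of $\mathcal{M}\oplus\mathcal{N}$. The following statements are equivalent: (i) $\mathcal{M}\simeq_\varepsilon\mathcal{N}$. (ii) There is an $\varepsilon$-perturbation of $\mathcal{M}\oplus\mathcal{N}$ in which $s_{init}^{\mathcal{M}}\sim s_{init}^{\mathcal{N}}$. (iii) There is a transitive $\varepsilon$-bisimulation $R$ on $\mathcal{M}\oplus\mathcal{N}$ with $(s_{init}^{\mathcal{M}},s_{init}^{\mathcal{N}})\in R$ such that for each $A\in S/R$ there is a distribution $P_A^*\in Distr(S/R)$ with $|P(s)(C)-P_A^*(C)|\le\frac{\varepsilon}{2}$ for all $s\in A$ and all $R$-closed sets $C\subseteq S$.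
   Context: Fix a countable set $AP$ of atomic propositions. A labeled Markov chain (LMC) $\mathcal{M}=(S,P,s_{init},l)$ has a countable nonempty state set $S$, a transition function $P\colon S\to Distr(S)$ ($Distr(X)$ is the set of probability distributions on $X$), an initial state $s_{init}\in S$ and a labeling $l\colon S\to 2^{AP}$. It is finite if $S$ is finite. For $A\subseteq S$, $P(s)(A)=\sum_{t\in A}P(s)(t)$. The direct sum $\mathcal{M}\oplus\mathcal{N}$ is the LMC on the disjoint union of the state spaces with inherited transitions and labels (its initial state is irrelevant). For $R\subseteq S\times S$ and $A\subseteq S$ let $R(A)=\{t\mid\exists s\in A\colon(s,t)\in R\}$; $A$ is $R$-closed if $R(A)\subseteq A$. For an equivalence $R$, $S/R$ is the set of equivalence classes, and the $R$-closed sets are exactly the unions of classes; for $\mu\in Distr(S/R)$ and $C$ $R$-closed, $\mu(C)=\sum_{B\in S/R,\,B\subseteq C}\mu(B)$. An equivalence $R\subseteq S\times S$ is a (probabilistic) bisimulation if for all $(s,t)\in R$ and all $R$-equivalence classes $C$: $l(s)=l(t)$ and $P(s)(C)=P(t)(C)$. $s\sim t$ if $s,t$ are related by some bisimulation. An $\varepsilon$-perturbation of $\mathcal{M}=(S,P,s_{init},l)$ is an LMC $\mathcal{M}'=(S,P',s_{init},l)$ with $\|P(s)-P'(s)\|_1=\sum_{t\in S}|P(s)(t)-P'(s)(t)|\le\varepsilon$ for all $s\in S$. An equivalence $R$ on $S$ is an $\varepsilon$-perturbed bisimulation on $\mathcal{M}$ if there is an $\varepsilon$-perturbation $\mathcal{M}'$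 of $\mathcal{M}$ such that $R$ is a bisimulation on $\mathcal{M}'$. $s\simeq_\varepsilon t$ if $(s,t)\in R$ for some $\varepsilon$-perturbed bisimulation $R$; $\mathcal{M}\simeq_\varepsilon\mathcal{N}$ if $s_{init}^{\mathcal{M}}\simeq_\varepsilon s_{init}^{\mathcal{N}}$ in $\mathcal{M}\oplus\mathcal{N}$. A reflexive and symmetric $R$ is an $\varepsilon$-bisimulation if for all $(s,t)\in R$ and all $A\subseteq S$: $l(s)=l(t)$ and $P(s)(A)\le P(t)(R(A))+\varepsilon$. *)

(* Defs.v *)
From HB Require Import structures.
From mathcomp Require Import all_boot all_order all_algebra.
From mathcomp Require Import classical_sets reals.

Set Implicit Arguments.
Unset Strict Implicit.
Unset Printing Implicit Defensive.

Import Order.TTheory GRing.Theory Num.Theory.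
Local Open Scope ring_scope.

Record distr (R : realType) (X : finType) := Distr {
  mass :> X -> R;
  mass_ge0 : forall x, 0 <= mass x;
  mass_sum1 : \sum_x mass x = 1 }.

Definition prob (R : realType) (X : finType) (mu : distr R X) (A : {set X}) : R :=
  \sum_(x in A) mu x.

(* Finite labeled Markov chains: the state space is a finType, nonempty since
   it contains [init]. *)
Record lmc (R : realType) (AP : countType) := Lmc {
  state : finType;
  trans : state -> distr R state;
  init : state;
  label : state -> set AP }.

Arguments trans {R AP} l _ : rename.
Arguments init {R AP} l : rename.
Arguments label {R AP} l _ : rename.

Section DirectSum.
Variables (R : realType) (AP : countType) (M N : lmc R AP).

Definition sum_mass (s t : (state M + state N)%type) : R :=
  match s, t with
  | inl s, inl t => trans M s t
  | inr s, inr t => trans N s t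
  | _, _ => 0
  end.

Lemma sum_mass_ge0 s t : 0 <= sum_mass s t.
Proof. by case: s t => s [] t //=; apply: mass_ge0. Qed.

Lemma sum_mass_sum1 s : \sum_t sum_mass s t = 1.
Proof.
rewrite big_sumType /=; case: s => s /=.
  by rewrite [X in _ + X]big1 // addr0 mass_sum1.
by rewrite [X in X + _]big1 // add0r mass_sum1.
Qed.

(* The choice of initial state is irrelevant. *)
Definition direct_sum : lmc R AP :=
  @Lmc R AP (state M + state N)%type
    (fun s => Distr (sum_mass_ge0 s) (sum_mass_sum1 s))
    (inl (init M))
    (fun s => match s with inl s => label M s | inr s => label N s end).

End DirectSum.

Section Relations.
Variable S : finType.
Implicit Types (r : rel S) (A : {set S}).

Definition rel_image r A : {set S} := [set t | [exists s in A, r s t]].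

Definition rel_closed r A : bool := rel_image r A \subset A.

(* The quotient S/r, whose elements are the equivalence classes of r (only
   meaningful when r is an equivalence). *)
Definition quot r : finType :=
  {B : {set S} | B \in equivalence_partition r [set: S]}.

(* mu(C) for mu a distribution on S/r and C an r-closed set. *)
Definition quot_prob (R : realType) r (mu : distr R (quot r)) (C : {set S}) : R :=
  \sum_(B : quot r | val B \subset C) mu B.

End Relations.

Section Bisimulations.
Variables (R : realType) (AP : countType).
Implicit Types (M N : lmc R AP) (eps : R).

Definition bisimulation M (r : rel (state M)) : Prop :=
  equivalence_rel r /\
  forall s t, r s t -> forall C : quot r,
    label M s = label M t /\
    prob (trans M s) (val C) = prob (trans M t) (val C).

Definition bisimilar M (s t : state M) : Prop :=
  exists r : rel (state M), bisimulation r /\ r s t.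

Definition with_trans M (P' : state M -> distr R (state M)) : lmc R AP :=
  Lmc P' (init M) (label M).

(* As an eps-perturbation of M differs from M in its transition function only,
   it is represented by that function P'; the LMC itself is [with_trans P']. *)
Definition perturbation eps M (P' : state M -> distr R (state M)) : Prop :=
  forall s, \sum_t `|trans M s t - P' s t| <= eps.

Definition perturbed_bisimulation eps M (r : rel (state M)) : Prop :=
  equivalence_rel r /\
  exists P' : state M -> distr R (state M),
    perturbation eps P' /\ @bisimulation (with_trans P') r.

Definition perturbed_bisimilar eps M (s t : state M) : Prop :=
  exists r : rel (state M), perturbed_bisimulation eps r /\ r s t.

Definition perturbed_bisimilar_lmc eps M N : Prop :=
  @perturbed_bisimilar eps (direct_sum M N) (inl (init M)) (inr (init N)).

Definition eps_bisimulation eps M (r : rel (state M)) : Prop :=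
  [/\ reflexive r, symmetric r &
      forall s t, r s t -> forall A : {set state M},
        label M s = label M t /\
        prob (trans M s) A <= prob (trans M t) (rel_image r A) + eps].

End Bisimulations.

(* Main.v *)
(* For (iii) => (ii), each P(s) is rescaled inside every class B of r so that B
   gets mass P_A^*(B), A being the class of s.  All states of B then move in the
   same direction, so the l1 distance between P(s) and its perturbation is
   attained on r-closed sets: it is the deviation on the union of the classes
   that gain mass plus the deviation on the union of those that lose mass,
   hence at most eps / 2 + eps / 2.  For (ii) => (iii), P_A^* is the common
   image in S/r of the perturbed P'(s), s in A; a perturbation by eps in l1
   distance changes the mass of a set by at most eps / 2. *)
Require Import Defs.
From HB Require Import structures.
From mathcomp Require Import all_boot all_order all_algebra.
From mathcomp Require Import classical_sets reals.
From mathcomp Require Import lra.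

Set Implicit Arguments.
Unset Strict Implicit.
Unset Printing Implicit Defensive.

Import Order.TTheory GRing.Theory Num.Theory.
Local Open Scope ring_scope.

Lemma equivalence_rel_of (S : Type) (r : rel S) :
  reflexive r -> symmetric r -> transitive r -> equivalence_rel r.
Proof.
move=> rr rs rt; apply/equivalence_relP; split=> // x y rxy.
exact: (sym_left_transitive rs rt).
Qed.

(** * Masses of sets and the l1 distance *)

Section Probability.
Variables (R : realType) (X : finType).
Implicit Types (mu nu : distr R X) (A B : {set X}).

Lemma prob_ge0 mu A : 0 <= prob mu A.
Proof. by apply: sumr_ge0 => x _; apply: mass_ge0. Qed.

Lemma prob_sub mu A B : A \subset B -> prob mu A <= prob mu B.
Proof.
move=> /fintype.subsetP AB; rewrite /prob big_mkcond [leRHS]big_mkcond /=.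
apply: ler_sum => x _; have := AB x; case: (x \in A) => [->//|_].
by case: ifP => // _; apply: mass_ge0.
Qed.

Lemma prob_setC mu A : prob mu (~: A) = 1 - prob mu A.
Proof.
rewrite -(mass_sum1 mu) (bigID (mem A)) /= addrAC subrr add0r.
by apply: eq_bigl => x; rewrite inE.
Qed.

(** Both distributions have total mass 1, so the deviations on [A] and on its complement are
    opposite; their absolute values are equal and add up to at most the l1 distance. *)
Lemma prob_dist_le_half_l1 mu nu A :
  `|prob mu A - prob nu A| <= (\sum_x `|mu x - nu x|) / 2.
Proof.
have dist_le (B : {set X}) :
    `|prob mu B - prob nu B| <= \sum_(x in B) `|mu x - nu x|.
  by rewrite /prob -sumrB; apply: ler_norm_sum.
have := dist_le (~: A); have := dist_le A.
have -> : prob mu (~: A) - prob nu (~: A) = - (prob mu A - prob nu A).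
  by rewrite !prob_setC; lra.
rewrite normrN [X in _ -> _ -> _ <= X / _](bigID (mem A)) /=.
rewrite [in X in _ -> X -> _](eq_bigl (fun x => x \notin A)); last by move=> x; rewrite inE.
lra.
Qed.

End Probability.

(** * Equivalence classes and closed sets *)

Section Quotient.
Variables (S : finType) (r : rel S).
Hypothesis r_equiv : equivalence_rel r.
Implicit Types (B : quot r) (C : {set S}).

(** The set is spelled as in [equivalence_partition], so that it lies in the partition by
    [imset_f]. *)
Definition cls (s : S) : quot r :=
  Sub [set t in [set: S] | r s t] (imset_f _ (finset.in_setT s)).

Lemma in_cls s t : (t \in val (cls s)) = r s t.
Proof. by rewrite SubK !inE. Qed.

Lemma cls_surj B : exists s, cls s == B.
Proof. by case/imsetP: (valP B) => s _ Bs; exists s; apply/eqP/val_inj. Qed.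

Definition cls_repr B : S := xchoose (cls_surj B).

Lemma cls_reprK : cancel cls_repr cls.
Proof. by move=> B; apply/eqP/(xchooseP (cls_surj B)). Qed.

Lemma eq_cls s t : (cls s == cls t) = r s t.
Proof.
have rr x : r x x by case: (r_equiv x x x).
have rE x y z : r x y -> r x z = r y z by case: (r_equiv x y z).
apply/eqP/idP => [st|rst]; first by rewrite -in_cls st in_cls.
by apply/val_inj/finset.setP => u; rewrite !in_cls; apply: rE.
Qed.

Lemma mem_cls B t : (t \in val B) = (cls t == B).
Proof. by rewrite -[in LHS](cls_reprK B) in_cls -eq_cls cls_reprK eq_sym. Qed.

Lemma rel_closedP C :
  reflect (forall s t, cls s = cls t -> s \in C -> t \in C) (rel_closed r C).
Proof.
apply: (iffP fintype.subsetP) => [Cr s t /eqP st sC|Cr t].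
  by apply: Cr; rewrite inE; apply/existsP; exists s; rewrite sC -eq_cls.
by rewrite inE => /existsP[s /andP[sC]]; rewrite -eq_cls => /eqP/Cr; apply.
Qed.

Lemma cls_subset C t :
  rel_closed r C -> (val (cls t) \subset C) = (t \in C).
Proof.
move=> /rel_closedP Cr; apply/fintype.subsetP/idP => [|tC u]; first by apply; rewrite mem_cls.
by rewrite mem_cls => /eqP ut; apply: (Cr t).
Qed.

Lemma rel_closed_setT : rel_closed r [set: S].
Proof. exact: finset.subsetT. Qed.

Lemma rel_closed_cls B : rel_closed r (val B).
Proof. by apply/rel_closedP => s t st; rewrite !mem_cls st. Qed.

Lemma rel_closed_image C : rel_closed r (rel_image r C).
Proof.
apply/rel_closedP => s t st; rewrite !inE => /existsP[u /andP[uC us]].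
by apply/existsP; exists u; rewrite uC -eq_cls -st eq_cls.
Qed.

Lemma sub_rel_image C : C \subset rel_image r C.
Proof.
by apply/fintype.subsetP => s sC; rewrite inE; apply/existsP; exists s; rewrite sC -eq_cls /=.
Qed.

(** A closed set is the disjoint union of the classes it contains, so the sum can be grouped by the
    class of its index. *)
Lemma sum_closed (V : nmodType) (f : S -> V) C : rel_closed r C ->
  \sum_(t in C) f t = \sum_(B : quot r | val B \subset C) \sum_(t in val B) f t.
Proof.
move=> Cr; rewrite (partition_big cls (fun B => val B \subset C)) /=; last first.
  by move=> t; rewrite cls_subset.
apply: eq_bigr => B BC; apply: eq_bigl => t; rewrite mem_cls.
by case: eqP => [tB|]; rewrite ?andbF ?andbT // -cls_subset // tB.
Qed.

Lemma sum_quot (V : nmodType) (f : S -> V) :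
  \sum_t f t = \sum_(B : quot r) \sum_(t in val B) f t.
Proof.
have := sum_closed f rel_closed_setT.
rewrite (eq_bigl predT); last by move=> t; rewrite inE.
by move=> ->; apply: eq_bigl => B; rewrite finset.subsetT.
Qed.

(** * Passing between distributions on [S] and on the quotient *)

Section QuotientDistribution.
Variable R : realType.
Implicit Types (mu : distr R S) (nu : distr R (quot r)).

Lemma quot_mass_sum1 mu : \sum_(B : quot r) prob mu (val B) = 1.
Proof. by rewrite -sum_quot mass_sum1. Qed.

Definition quot_distr mu : distr R (quot r) :=
  Distr (fun B => prob_ge0 mu (val B)) (quot_mass_sum1 mu).

Lemma quot_prob_distr mu C :
  rel_closed r C -> quot_prob (quot_distr mu) C = prob mu C.
Proof. by move=> Cr; rewrite [RHS]sum_closed. Qed.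

(* The conditional distribution of [mu] on the class of [t]; a Dirac mass when
   that class is [mu]-null. *)
Definition cond_mass mu t : R :=
  let p := prob mu (val (cls t)) in
  if p == 0 then (t == cls_repr (cls t))%:R else mu t / p.

Lemma cond_mass_ge0 mu t : 0 <= cond_mass mu t.
Proof.
by rewrite /cond_mass; case: ifP => // _; rewrite divr_ge0 ?mass_ge0 ?prob_ge0.
Qed.

(** On a null class both sides vanish: nonnegative masses with sum 0 are all 0. *)
Lemma cond_massE mu t : mu t = prob mu (val (cls t)) * cond_mass mu t.
Proof.
rewrite /cond_mass; case: eqP => [p0|/eqP p0]; last by rewrite mulrC divfK.
rewrite p0 mul0r; apply: (psumr_eq0P _ p0); last by rewrite mem_cls.
by move=> u _; apply: mass_ge0.
Qed.

Lemma sum_cond_mass mu B : \sum_(t in val B) cond_mass mu t = 1.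
Proof.
rewrite (eq_bigr (fun t => if prob mu (val B) == 0 then (t == cls_repr B)%:R
                           else mu t / prob mu (val B))); last first.
  by move=> t; rewrite mem_cls /cond_mass => /eqP ->.
case: (eqVneq (prob mu (val B)) 0) => [_|p0]; last by rewrite -mulr_suml divff.
rewrite (bigD1 (cls_repr B)) ?mem_cls ?cls_reprK //= eqxx big1 ?addr0 //.
by move=> t /andP[_ /negPf ->].
Qed.

(** The law of a state drawn in two stages: a class according to [nu], then a state in it according
    to [mu] conditioned on that class. *)
Definition rescale_mass mu nu t : R := nu (cls t) * cond_mass mu t.

Lemma rescale_mass_ge0 mu nu t : 0 <= rescale_mass mu nu t.
Proof. by rewrite mulr_ge0 ?mass_ge0 ?cond_mass_ge0. Qed.

Lemma rescale_mass_cls mu nu B : \sum_(t in val B) rescale_mass mu nu t = nu B.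
Proof.
rewrite (eq_bigr (fun t => nu B * cond_mass mu t)); last first.
  by move=> t; rewrite mem_cls /rescale_mass => /eqP ->.
by rewrite -mulr_sumr sum_cond_mass mulr1.
Qed.

Lemma rescale_mass_sum1 mu nu : \sum_t rescale_mass mu nu t = 1.
Proof.
rewrite sum_quot -(mass_sum1 nu); apply: eq_bigr => B _.
exact: rescale_mass_cls.
Qed.

Definition rescale mu nu : distr R S :=
  Distr (rescale_mass_ge0 mu nu) (rescale_mass_sum1 mu nu).

Lemma prob_rescale mu nu C :
  rel_closed r C -> prob (rescale mu nu) C = quot_prob nu C.
Proof.
move=> Cr; rewrite /prob sum_closed //; apply: eq_bigr => B _.
exact: rescale_mass_cls.
Qed.

Lemma l1_rescale_le mu nu d :
  (forall C, rel_closed r C -> `|prob mu C - quot_prob nu C| <= d) ->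
  \sum_t `|mu t - rescale mu nu t| <= d + d.
Proof.
(* [D] is the union of the classes whose mass does not decrease; it and its complement are closed,
   so [dist_le] applies to both. *)
move=> dist_le; pose D := [set t | prob mu (val (cls t)) <= nu (cls t)].
have Dr : rel_closed r D by apply/rel_closedP => s t st; rewrite !inE st.
have DCr : rel_closed r (~: D).
  by apply/rel_closedP => s t st; rewrite !inE st.
(* The first factor depends on the class only and the second is nonnegative, so the sign is constant
   on each class. *)
have diffE t :
    mu t - rescale mu nu t = (prob mu (val (cls t)) - nu (cls t)) * cond_mass mu t.
  by rewrite mulrBl -cond_massE.
rewrite (bigID (mem D)) /=; apply: lerD.
  apply: le_trans (dist_le D Dr); rewrite -(prob_rescale mu) // distrC /prob -sumrB.
  (* On [D] each absolute value is the rescaled mass minus the original one, so the remaining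
     inequality is an equality of sums. *)
  apply: le_trans (ler_norm _); rewrite le_eqVlt; apply/orP; left.
  apply/eqP/eq_bigr => t; rewrite inE -subr_le0 => tD.
  by rewrite ler0_norm ?opprB // diffE mulr_le0_ge0 ?cond_mass_ge0.
apply: le_trans (dist_le _ DCr); rewrite -(prob_rescale mu) // /prob -sumrB.
apply: le_trans (ler_norm _); rewrite le_eqVlt; apply/orP; left.
rewrite [eqbRHS](eq_bigl (fun t => t \notin D)); last by move=> t; rewrite inE.
apply/eqP/eq_bigr => t; rewrite inE -ltNge -subr_gt0 => tD.
by rewrite ger0_norm // diffE mulr_ge0 ?cond_mass_ge0 // ltW.
Qed.

End QuotientDistribution.
End Quotient.

(** * Bisimulations on closed sets *)

Section Bisimulation.
Variables (R : realType) (AP : countType) (M : lmc R AP).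
Variable r : rel (state M).

Lemma bisimulation_prob_closed s t C :
  bisimulation r -> r s t -> rel_closed r C ->
  prob (trans M s) C = prob (trans M t) C.
Proof.
move=> [r_equiv bis] rst Cr; rewrite /prob !(sum_closed r_equiv _ Cr).
by apply: eq_bigr => B _; case: (bis s t rst B).
Qed.

End Bisimulation.

(** * Perturbed bisimulations and central distributions *)

Section Perturbation.
Variables (R : realType) (AP : countType) (M : lmc R AP) (eps : R).
Variable r : rel (state M).

Lemma perturbation_prob_dist (P' : state M -> distr R (state M)) s A :
  perturbation eps P' -> `|prob (trans M s) A - prob (P' s) A| <= eps / 2.
Proof.
move=> /(_ s) pert; apply: le_trans (prob_dist_le_half_l1 _ _ _) _.
by rewrite ler_pM2r ?invr_gt0.
Qed.

(** [P' s] and [P' t] agree on the closed set [rel_image r A]; going from [trans M s] to [P' s] and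
    from [P' t] to [trans M t] costs [eps / 2] each. *)
Lemma perturbed_bisimulation_eps (P' : state M -> distr R (state M)) :
  perturbation eps P' -> @bisimulation R AP (with_trans P') r ->
  eps_bisimulation eps r.
Proof.
move=> pert bis; have r_equiv := bis.1.
split=> [s|s t|s t rst A].
- by case: (r_equiv s s s).
- by rewrite -!(eq_cls r_equiv) eq_sym.
split; first by case: (bis.2 s t rst (cls r s)).
have RA := rel_closed_image r_equiv A.
have le1 := prob_sub (trans M s) (sub_rel_image r_equiv A).
have := perturbation_prob_dist s (rel_image r A) pert.
have := perturbation_prob_dist t (rel_image r A) pert.
have /= -> := bisimulation_prob_closed bis rst RA.
rewrite !ler_norml; lra.
Qed.

Lemma perturbed_bisimulation_center (P' : state M -> distr R (state M)) (A : quot r) :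
  perturbation eps P' -> @bisimulation R AP (with_trans P') r ->
  exists PA : distr R (quot r), forall s, s \in val A ->
    forall C, rel_closed r C -> `|prob (trans M s) C - quot_prob PA C| <= eps / 2.
Proof.
move=> pert bis; have r_equiv := bis.1.
(* Any state of [A] would give the same distribution on the quotient, by bisimilarity under [P']. *)
exists (quot_distr r_equiv (P' (cls_repr A))) => s sA C Cr.
rewrite quot_prob_distr //.
have rs : r (cls_repr A) s by rewrite -in_cls cls_reprK.
have /= -> := bisimulation_prob_closed bis rs Cr.
exact: perturbation_prob_dist.
Qed.

(** After rescaling, the class masses at [s] are those of the center of the class of [s], hence they
    are shared by related states. *)
Lemma centers_perturbed_bisimulation :
  equivalence_rel r -> (forall s t, r s t -> label M s = label M t) ->
  (forall A : quot r, exists PA : distr R (quot r), forall s, s \in val A ->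
    forall C, rel_closed r C -> `|prob (trans M s) C - quot_prob PA C| <= eps / 2) ->
  exists P' : state M -> distr R (state M),
    perturbation eps P' /\ @bisimulation R AP (with_trans P') r.
Proof.
(* The quotient is finite, so a center can be chosen for all classes at once. *)
move=> r_equiv lab /fin_all_exists[PA PA_center].
exists (fun s => rescale r_equiv (trans M s) (PA (cls r s))); split=> [s|].
  rewrite [leRHS]splitr; apply: l1_rescale_le => C Cr.
  by apply: PA_center; rewrite ?mem_cls.
split=> // s t rst C; split; first exact: lab.
rewrite /= !prob_rescale ?rel_closed_cls //.
by move: rst; rewrite -(eq_cls r_equiv) => /eqP ->.
Qed.

End Perturbation.

(** * The equivalences *)

Theorem theorem4p10 (R : realType) (AP : countType) (eps : R)
    (eps_ge0 : 0 <= eps) (eps_le1 : eps <= 1) (M N : lmc R AP) :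
  let MN := direct_sum M N in
  let sM : state MN := inl (init M) in
  let sN : state MN := inr (init N) in
  let i := perturbed_bisimilar_lmc eps M N in
  let ii :=
    exists P' : state MN -> distr R (state MN),
      perturbation eps P' /\ @bisimilar R AP (with_trans P') sM sN in
  let iii :=
    exists r : rel (state MN),
      [/\ eps_bisimulation eps r, transitive r, r sM sN &
          forall A : quot r, exists PA : distr R (quot r),
            forall s : state MN, s \in val A ->
            forall C : {set state MN}, rel_closed r C ->
              `|prob (trans MN s) C - quot_prob PA C| <= eps / 2] in
  (i <-> ii) /\ (ii <-> iii).
Proof.
move=> MN sM sN i ii iii; split.
  (* (i) and (ii) differ only in the order in which the relation and the perturbation are
     quantified. *)
  split=> [[r [[_ [P' [pert bis]]] rMN]]|[P' [pert [r [bis rMN]]]]].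
    by exists P'; split=> //; exists r.
  by exists r; split=> //; split; [exact: bis.1 | exists P'].
split=> [[P' [pert [r [bis rMN]]]]|[r [[rr rs reps] rt rMN centers]]].
  exists r; split=> //.
  - exact: perturbed_bisimulation_eps pert bis.
  - by move=> t s u; rewrite -!(eq_cls bis.1) => /eqP ->.
  - by move=> A; apply: perturbed_bisimulation_center pert bis.
have lab s t : r s t -> label MN s = label MN t.
  (* The label condition sits under the quantifier over sets; any set releases it. *)
  by move=> rst; case: (reps s t rst finset.set0).
have [P' [pert bis]] :=
  centers_perturbed_bisimulation (equivalence_rel_of rr rs rt) lab centers.
by exists P'; split=> //; exists r.
Qed.
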